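(* Let $Q,B$ be $n\times n$ real matrices satisfying the standing assumptions, with local homogeneous dimension $D$ and volume function $V$. Suppose that $\operatorname{Rank}(Q)<n$ and that $B$ is similar to a (real) skew-symmetric matrix. Then, with $D_\infty=n$, one has $2\le D_\infty<D$ and there exists $\gamma>0$ such that $$V(t)\ge\gamma\min\{t^{D},t^{D_\infty}\}\qquad\text{for every }t>0.$$
   Context: Standing assumptions. $n\ge2$; $Q,B$ are constant real $n\times n$ matrices, $Q=Q^\star\ge0$ ($^\star$ is transpose). $\operatorname{Ker}Q$ contains no nontrivial invariant subspace of $B^\star$; equivalently the Gramian $Q(t)=\int_0^te^{sB}Qe^{sB^\star}ds$ is positive definite for every $t>0$. Moreover $Q,B$ are in canonical form: $Q=\begin{pmatrix}Q_0&0\\0&0\end{pmatrix}$ with $Q_0=Q_0^\star>0$ of size $p_0\times p_0$, and with respect to the block partition $n=p_0+p_1+\dots+p_\nu$, $p_0\ge p_1\ge\dots\ge p_\nu\ge1$, the matrix $B$ has subdiagonal blocks $B_1,\dots,B_\nu$, where $B_j$ is $p_j\times p_{j-1}$ of rank $p_j$ (in block position row $j$, column $j-1$, blocks numbered from $0$), all blocks strictly below the subdiagonal are zero, and all blocks on or above the diagonal are arbitrary. Local homogeneous dimension: $D=p_0+3p_1+5p_2+\dots+(2\nu+1)p_\nu$. Volume function: $V(t)=\det Q(t)$, $t>0$. *)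

(* Defs.v *)
From HB Require Import structures.
From mathcomp Require Import all_boot all_order all_algebra.
From mathcomp Require Import all_classical all_reals all_analysis.

Set Implicit Arguments.
Unset Strict Implicit.
Unset Printing Implicit Defensive.

Import Order.TTheory GRing.Theory Num.Theory.
Import numFieldNormedType.Exports.

Local Open Scope classical_set_scope.
Local Open Scope ring_scope.

Definition quad_form (R : realType) (n : nat) (M : 'M[R]_n) (x : 'cV[R]_n) : R :=
  (x^T *m M *m x) 0 0.

Definition sym_psd (R : realType) (n : nat) (M : 'M[R]_n) : Prop :=
  M^T = M /\ forall x : 'cV[R]_n, 0 <= quad_form M x.

Definition sym_pd (R : realType) (n : nat) (M : 'M[R]_n) : Prop :=
  M^T = M /\ forall x : 'cV[R]_n, x != 0 -> 0 < quad_form M x.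

Definition expmx (R : realType) (n : nat) (A : 'M[R]_n) : 'M[R]_n :=
  limn [series k`!%:R^-1 *: A ^+ k]_k.

Definition gramian (R : realType) (n : nat) (Q B : 'M[R]_n) (t : R) : 'M[R]_n :=
  \matrix_(i, j) \int[lebesgue_measure]_(s in `[0, t])
    (expmx (s *: B) *m Q *m expmx (s *: B^T)) i j.

Definition volume (R : realType) (n : nat) (Q B : 'M[R]_n) (t : R) : R :=
  \det (gramian Q B t).

Definition ker_without_invariant (R : realType) (n : nat) (Q B : 'M[R]_n) : Prop :=
  forall U : {vspace 'cV[R]_n},
    (forall x, x \in U -> Q *m x = 0) ->
    (forall x, x \in U -> B^T *m x \in U) ->
    U = 0%VS.

(* The nu.+1 blocks of sizes p 0, ..., p nu are numbered from 0; submxblock M i j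
   is the (p i) x (p j) block of M in block row i and block column j. *)
Record canonical_form (R : realType) (nu : nat) (p : 'I_nu.+1 -> nat)
    (Q B : 'M[R]_(\sum_i p i)) : Prop := CanonicalForm {
  block_size_gt0 : forall i, (0 < p i)%N;
  block_size_nonincreasing : forall i j : 'I_nu.+1, (i <= j)%N -> (p j <= p i)%N;
  Q_first_block : sym_pd (submxblock Q ord0 ord0);
  Q_other_blocks : forall i j, (i, j) != (ord0, ord0) -> submxblock Q i j = 0;
  B_subdiagonal : forall i j : 'I_nu.+1,
    i = j.+1 :> nat -> \rank (submxblock B i j) = p i;
  B_below_subdiagonal : forall i j : 'I_nu.+1,
    (j.+1 < i)%N -> submxblock B i j = 0
}.

(* The equation n = \sum_i p i lets Q and B keep the dimension n in their type. *)
Record standing_assumptions (R : realType) (n nu : nat) (p : 'I_nu.+1 -> nat)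
    (e : n = (\sum_i p i)%N) (Q B : 'M[R]_n) : Prop := StandingAssumptions {
  dim_ge2 : (2 <= n)%N;
  Q_sym_psd : sym_psd Q;
  kerQ_noninvariant : ker_without_invariant Q B;
  QB_canonical : canonical_form (castmx (e, e) Q) (castmx (e, e) B)
}.

Definition local_hom_dim (nu : nat) (p : 'I_nu.+1 -> nat) : nat :=
  (\sum_(i < nu.+1) i.*2.+1 * p i)%N.

(* Main.v *)
(** Write A = B^T and y(s) = exp(sA) x, so that the quadratic form of Q(t) at x is the
    integral over [0, t] of the form of Q at y(s), which dominates the squared norm of
    the first block of y(s).

    Small t: expand the first block of y in powers of s up to order nu.  The Hilbert
    matrix is positive definite, so the integral of the square of the Taylor polynomial
    dominates sum_k t^(2k+1) |(A^k x)_0|^2.  As the subdiagonal blocks of B have full row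
    rank, these coefficients control all of x, block k being recovered from the first
    k + 1 of them; the remainder is of higher order in t.  Hence the form of Q(t) is at
    least c sum_k t^(2k+1) |x_k|^2 for t at most some t0.

    Large t: A preserves the form of some W^T W with W invertible, so |y(s)| is comparable
    with |x| for all s.  As translates of solutions are solutions, the small-time estimate
    applies on every interval [s, s + t0], and the form of Q(t) is at least c t |x|^2.

    Both bounds are diagonal, and a symmetric matrix whose form dominates that of a
    positive diagonal matrix has at least its determinant (Schur complements). *)
Require Import Defs.
From HB Require Import structures.
From mathcomp Require Import all_boot all_order all_algebra.
From mathcomp Require Import all_classical all_reals all_analysis.
From mathcomp Require Import ring lra.

Set Implicit Arguments.
Unset Strict Implicit.
Unset Printing Implicit Defensive.

Import Order.TTheory GRing.Theory Num.Theory.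
Import numFieldNormedType.Exports.

Local Open Scope ring_scope.

(** * Quadratic forms and Schur complements *)

Definition schur (R : realType) n (M : 'M[R]_(1 + n)) : 'M[R]_n :=
  drsubmx M - (M 0 0)^-1 *: (dlsubmx M *m ursubmx M).

Lemma trmx_schur (R : realType) n (M : 'M[R]_(1 + n)) :
  M^T = M -> (schur M)^T = schur M.
Proof.
move=> Msym; rewrite /schur linearB linearZ /= trmx_mul trmx_drsub trmx_dlsub.
by rewrite trmx_ursub Msym.
Qed.

Lemma quad_form_sum (R : realType) n (M : 'M[R]_n) (x : 'cV[R]_n) :
  quad_form M x = \sum_i \sum_j x i 0 * M i j * x j 0.
Proof.
rewrite /quad_form mxE exchange_big /=; apply: eq_bigr => j _.
by rewrite mxE mulr_suml; apply: eq_bigr => i _; rewrite mxE.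
Qed.

(** Completing the square in the first coordinate; symmetry of [M] makes the two cross terms
    equal. *)
Lemma quad_form_schur (R : realType) n (M : 'M[R]_(1 + n)) (x : 'cV[R]_(1 + n)) :
  M^T = M -> M 0 0 != 0 ->
  quad_form M x =
    M 0 0 * (x 0 0 + (M 0 0)^-1 * \sum_i M 0 (rshift 1 i) * dsubmx x i 0) ^+ 2
    + quad_form (schur M) (dsubmx x).
Proof.
move=> Msym M0; rewrite !quad_form_sum.
have Ms i j : M i j = M j i by rewrite -{1}Msym mxE.
have l0 : lshift n (0 : 'I_1) = 0 by apply/val_inj.
pose b i := M 0 (rshift 1 i); pose z i := dsubmx x i 0.
set s := \sum_i _ * _.
have sE : \sum_i b i * z i = s by [].
have -> : \sum_i \sum_j dsubmx x i 0 * schur M i j * dsubmx x j 0 =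
    \sum_i \sum_j z i * M (rshift 1 i) (rshift 1 j) * z j - (M 0 0)^-1 * s ^+ 2.
  rewrite -sE expr2 mulr_suml mulr_sumr -sumrB; apply: eq_bigr => i _.
  rewrite mulr_sumr mulr_sumr -sumrB; apply: eq_bigr => j _.
  by rewrite /schur !mxE big_ord1 !mxE l0 (Ms (rshift 1 i) 0) /z /b !mxE; ring.
rewrite big_split_ord big_ord1 l0 /= big_split_ord big_ord1 l0 /=.
have -> : \sum_(i < n) x 0 0 * M 0 (rshift 1 i) * x (rshift 1 i) 0 = x 0 0 * s.
  by rewrite -sE mulr_sumr; apply: eq_bigr => i _; rewrite /b /z mxE mulrA.
have -> : \sum_(i < n) \sum_(j < 1 + n)
      x (rshift 1 i) 0 * M (rshift 1 i) j * x j 0 = x 0 0 * s +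
    \sum_i \sum_j z i * M (rshift 1 i) (rshift 1 j) * z j.
  rewrite -sE mulr_sumr -big_split; apply: eq_bigr => i _ /=.
  rewrite big_split_ord big_ord1 l0 /= Ms /b /z !mxE; congr (_ + _); first by ring.
  by apply: eq_bigr => j _; rewrite mxE.
by field.
Qed.

Lemma det_schur (R : realType) n (M : 'M[R]_(1 + n)) :
  M 0 0 != 0 -> \det M = M 0 0 * \det (schur M).
Proof.
move=> M0; have l0 : lshift n (0 : 'I_1) = 0 by apply/val_inj.
have aE : ulsubmx M = (M 0 0)%:M.
  by apply/matrixP => i j; rewrite !ord1 !mxE !l0 eqxx.
(* One step of Gaussian elimination: a unit lower triangular block factor times an upper triangular
   one. *)
have MB : M = block_mx 1%:M 0 ((M 0 0)^-1 *: dlsubmx M) 1%:M *m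
              block_mx (M 0 0)%:M (ursubmx M) 0 (schur M).
  rewrite mulmx_block !mul1mx !mul0mx !addr0 -[LHS]submxK aE.
  rewrite mul_mx_scalar scalerA mulfV// scale1r.
  by rewrite /schur -scalemxAl addrCA subrr addr0.
by rewrite {1}MB det_mulmx det_lblock det_ublock !det1 !mul1r det_scalar1.
Qed.

Lemma quad_form_delta (R : realType) n (M : 'M[R]_n) i :
  quad_form M (delta_mx i 0) = M i i.
Proof.
rewrite quad_form_sum (bigD1 i)//= (bigD1 i)//= !mxE !eqxx mul1r mulr1.
rewrite big1 ?big1 ?addr0// => j /negPf ji; last by rewrite !mxE ji mulr0.
by apply: big1 => k _; rewrite !mxE ji !mul0r.
Qed.

(* Minimising the form over the first coordinate turns the hypothesis for M into
   the same hypothesis for the Schur complement. *)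
Lemma prod_le_det (R : realType) n (M : 'M[R]_n) (d : 'I_n -> R) :
  M^T = M -> (forall i, 0 < d i) ->
  (forall x : 'cV_n, \sum_i d i * x i 0 ^+ 2 <= quad_form M x) ->
  \prod_i d i <= \det M.
Proof.
elim: n M d => [|n IH] M d Msym d0 Md.
  by rewrite big_ord0 det_mx00.
have {}Md := Md : forall x : 'cV[R]_(1 + n), _.
have dM0 : d 0 <= M 0 0.
  rewrite -(quad_form_delta M 0); apply: le_trans (Md (delta_mx 0 0)).
  rewrite (bigD1 0)//= mxE eqxx expr1n mulr1 lerDl sumr_ge0// => i _.
  by rewrite mulr_ge0 ?sqr_ge0 ?ltW.
have M0 : 0 < M 0 0 by apply: lt_le_trans dM0.
rewrite big_ord_recl (@det_schur _ n M) ?gt_eqF//.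
have pr0 : 0 <= \prod_(i < n) d (lift ord0 i) by rewrite prodr_ge0// => i _; rewrite ltW.
apply: ler_pM => //; first exact: ltW.
apply: IH => [||x]; [exact: trmx_schur|by []|].
pose N : 'M[R]_(1 + n) := M; pose s := \sum_i N 0 (rshift 1 i) * x i 0.
(* This first coordinate annihilates the completed square, so that only the form of the Schur
   complement is left. *)
have := Md (col_mx (- (M 0 0)^-1 * s)%:M x).
rewrite quad_form_schur ?gt_eqF// col_mxKd.
have -> : (col_mx (- (M 0 0)^-1 * s)%:M x) 0 0 = - (M 0 0)^-1 * s.
  have -> : (0 : 'I_(1 + n)) = lshift n 0 by apply/val_inj.
  by rewrite col_mxEu mxE eqxx.
rewrite -/s mulNr addNr expr0n mulr0 add0r; apply: le_trans.
rewrite big_ord_recl ler_wpDl ?(mulr_ge0 (ltW (d0 _)) (sqr_ge0 _))//.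
rewrite le_eqVlt; apply/orP; left; apply/eqP/eq_bigr => i _.
set U := _%:M; suff -> : col_mx U x (lift ord0 i) 0 = x i 0 by [].
by rewrite -(col_mxEd U x); congr (col_mx U x _ 0); exact/val_inj.
Qed.

(** Cauchy-Schwarz with an unspecified constant that does not depend on [x]:
    [(u + v)^2 <= 2 u^2 + 2 v^2] is applied once per term. *)
Lemma sqr_sum_le (R : realType) (I : finType) (b : I -> R) :
  exists2 C, 0 < C & forall x : I -> R,
    (\sum_i b i * x i) ^+ 2 <= C * \sum_i x i ^+ 2.
Proof.
suff H (s : seq I) : exists2 C, 0 < C & forall x : I -> R,
    (\sum_(i <- s) b i * x i) ^+ 2 <= C * \sum_(i <- s) x i ^+ 2.
  have [C C0 HC] := H (index_enum I); exists C => // x; exact: HC.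
elim: s => [|i s [C C0 IH]].
  by exists 1 => // x; rewrite !big_nil expr0n mulr0.
exists (2 * b i ^+ 2 + 2 * C) => [|x].
  by have := sqr_ge0 (b i); lra.
rewrite !big_cons; have := IH x.
have : 0 <= \sum_(j <- s) x j ^+ 2 by rewrite sumr_ge0// => j _; rewrite sqr_ge0.
set u := \sum_(j <- s) x j ^+ 2; set v := \sum_(j <- s) _ => u0 vu.
have H1 : 0 <= (b i * x i - v) ^+ 2 by rewrite sqr_ge0.
have H2 : 0 <= C * x i ^+ 2 := mulr_ge0 (ltW C0) (sqr_ge0 _).
have H3 : 0 <= b i ^+ 2 * u by rewrite mulr_ge0 ?sqr_ge0.
nra.
Qed.

Lemma sqnorm_mulmx_le (R : realType) m n (M : 'M[R]_(m, n)) :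
  exists2 C, 0 < C & forall x : 'cV_n,
    \sum_i (M *m x) i 0 ^+ 2 <= C * \sum_i x i 0 ^+ 2.
Proof.
pose P i C := 0 < C /\ forall x : 'cV[R]_n, (M *m x) i 0 ^+ 2 <= C * \sum_j x j 0 ^+ 2.
have /choice[C HC] i : exists C, P i C.
  have [C C0 HC] := sqr_sum_le (M i); exists C; split=> // x.
  by rewrite mxE.
exists (1 + \sum_i C i) => [|x].
  by rewrite ltr_pwDl// sumr_ge0// => i _; have [/ltW] := HC i.
rewrite mulrDl mulr_suml ler_wpDl ?mul1r ?sumr_ge0// => [i _|]; first exact: sqr_ge0.
by apply: ler_sum => i _; have [_] := HC i.
Qed.

(** Induction on the dimension takes the place of compactness of the sphere: the Schur complement is
    again positive definite, hence coercive, and the completed square then controls the first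
    coordinate. *)
Lemma sym_pd_coercive (R : realType) n (M : 'M[R]_n) : sym_pd M ->
  exists2 c, 0 < c & forall x : 'cV_n, c * \sum_i x i 0 ^+ 2 <= quad_form M x.
Proof.
elim: n M => [|n IH] M [Msym Mpd].
  by exists 1 => // x; rewrite big_ord0 quad_form_sum big_ord0 mulr0.
pose N : 'M[R]_(1 + n) := M.
have M0 : 0 < M 0 0.
  rewrite -quad_form_delta Mpd//; apply/eqP => /matrixP/(_ 0 0).
  by rewrite !mxE eqxx => /eqP; rewrite oner_eq0.
have l0 : (0 : 'I_(1 + n)) = lshift n 0 by apply/val_inj.
have [|c c0 Sc] := IH (schur N).
  split; first exact: trmx_schur.
  move=> x x0; pose s := \sum_i N 0 (rshift 1 i) * x i 0.
  have := Mpd (col_mx (- (M 0 0)^-1 * s)%:M x : 'cV[R]_(1 + n)).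
  rewrite (@quad_form_schur _ n) ?gt_eqF// col_mxKd l0 col_mxEu mxE eqxx -l0.
  rewrite -/s mulNr addNr expr0n mulr0 add0r; apply.
  by apply: contraNneq x0 => /(congr1 (@dsubmx _ 1 n 1)); rewrite col_mxKd linear0 => ->.
have [C C0 HC] := sqr_sum_le (fun i => (M 0 0)^-1 * N 0 (rshift 1 i)).
pose a := M 0 0.
(* With [v] the completed square and [z = v - w], one has [z^2 <= 2 v^2 + 2 w^2] and [w^2 <= C Y].
   So the squared norm [z^2 + Y] is at most [2 v^2 + (2 C + 1) Y], where [a v^2] and [c Y] are each
   bounded by the form. *)
pose k := a^-1 * 2 + (2 * C + 1) * c^-1.
have k0 : 0 < k by rewrite addr_gt0 ?mulr_gt0 ?invr_gt0 ?addr_gt0 ?mulr_gt0.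
exists k^-1; first by rewrite invr_gt0.
move=> x; rewrite mulrC ler_pdivrMr// (@quad_form_schur _ n) ?gt_eqF//.
have := Sc (@dsubmx _ 1 n 1 x).
set q := quad_form _ _; set y := dsubmx _ => Hq.
rewrite big_ord_recl.
have -> : \sum_(i < n) x (lift ord0 i) 0 ^+ 2 = \sum_i y i 0 ^+ 2.
  apply: eq_bigr => i _; rewrite mxE; congr (x _ _ ^+ 2); exact/val_inj.
have := HC (fun i => y i 0); under eq_bigr do rewrite -mulrA; rewrite -mulr_sumr.
rewrite -/a; set w := a^-1 * _; set Y := \sum_i _ => Hw.
have Y0 : 0 <= Y by rewrite sumr_ge0// => j _; rewrite sqr_ge0.
have HY : Y <= c^-1 * q by rewrite mulrC ler_pdivlMr// mulrC.
set z := x ord0 0.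
set v := z + w; have zE : z = v - w by rewrite addrK.
have av : a^-1 * (a * v ^+ 2) = v ^+ 2 by rewrite mulKf// gt_eqF.
have H0 : 0 <= c^-1 * (a * v ^+ 2).
  by rewrite !(mulr_ge0 _ (mulr_ge0 _ (sqr_ge0 _))) ?invr_ge0 ?ltW.
have q0 : 0 <= q := le_trans (mulr_ge0 (ltW c0) Y0) Hq.
have H1 : 0 <= a^-1 * q by rewrite mulr_ge0// invr_ge0 ltW.
have -> : (a * v ^+ 2 + q) * k = 2 * v ^+ 2 + 2 * (a^-1 * q)
   + (2 * C + 1) * (c^-1 * (a * v ^+ 2)) + (2 * C + 1) * (c^-1 * q).
  by rewrite -{2}av /k; ring.
have H2 : 0 <= (v + w) ^+ 2 by rewrite sqr_ge0.
have H3 : 0 <= C * (c^-1 * (a * v ^+ 2)) := mulr_ge0 (ltW C0) H0.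
have H4 : C * Y <= C * (c^-1 * q) := ler_wpM2l (ltW C0) HY.
rewrite zE; nra.
Qed.

(** * Matrix exponential *)

Lemma cvg_mx_entries (R : realType) m n (u : nat -> 'M[R]_(m, n)) :
  (forall i j, cvgn (fun k => u k i j)) ->
  (u @ \oo --> \matrix_(i, j) limn (fun k => u k i j))%classic.
Proof.
move=> cu; apply/cvg_mx_entourageP => A entA.
have H (ij : 'I_m * 'I_n) : \forall k \near \oo%classic,
    ((\matrix_(i, j) limn (fun k => u k i j)) ij.1 ij.2, u k ij.1 ij.2) \in A.
  have /cvg_app_entourageP/(_ A entA) := cu ij.1 ij.2.
  by apply: filterS => k; rewrite mxE inE.
have : \forall k \near \oo%classic, forall ij : 'I_m * 'I_n,
    ((\matrix_(i, j) limn (fun k => u k i j)) ij.1 ij.2, u k ij.1 ij.2) \in A.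
  exact: filter_forall.
by apply: filterS => k Hk i j; exact: (Hk (i, j)).
Qed.

(** Geometric growth of the entries of the powers, so that the exponential series of a number
    dominates that of the matrix. The constant bounds every row sum of absolute values. *)
Lemma norm_expr_mx_le (R : realType) n (A : 'M[R]_n) :
  exists2 M, 0 < M & forall k i j, `|(A ^+ k) i j| <= M ^+ k.
Proof.
pose M := 1 + \sum_i \sum_j `|A i j|; exists M.
  by rewrite ltr_pwDl// sumr_ge0// => i _; rewrite sumr_ge0.
elim=> [|k IH] i j.
  by rewrite !expr0 mxE; case: eqP; rewrite ?normr1 ?normr0.
rewrite !exprS -mulmxE mxE; apply: le_trans (ler_norm_sum _ _ _) _.
apply: (@le_trans _ _ (\sum_l `|A i l| * M ^+ k)).
  by apply: ler_sum => l _; rewrite normrM ler_wpM2l.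
rewrite -mulr_suml ler_wpM2r//.
  by rewrite exprn_ge0// addr_ge0// sumr_ge0// => l _; rewrite sumr_ge0.
rewrite /M [in leRHS](bigD1 i)//= addrCA ler_wpDr// addr_ge0// sumr_ge0// => l _.
by rewrite sumr_ge0.
Qed.

(** Coefficients of entry [(i, j)] of [exp(sA)] as a scalar power series in [s], which opens the way
    to termwise differentiation. *)
Definition expmx_coef (R : realType) n (A : 'M[R]_n) i j : nat -> R :=
  fun k => k`!%:R^-1 * (A ^+ k) i j.

(** Formal differentiation is left multiplication by [A], because [(k + 1) / (k + 1)! = 1 / k!]. *)
Lemma pseries_diffs_expmx_coef (R : realType) n (A : 'M[R]_n) i j :
  pseries_diffs (expmx_coef A i j) =
  fun k => \sum_l A i l * expmx_coef A l j k.
Proof.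
apply/funext => k; rewrite /pseries_diffs /expmx_coef exprS -mulmxE mxE mulrA.
rewrite factS natrM invfM mulrA mulfV ?mul1r ?pnatr_eq0// mulr_sumr.
by apply: eq_bigr => l _; rewrite mulrCA.
Qed.

Lemma is_cvg_expmx_coef (R : realType) n (A : 'M[R]_n) i j s :
  cvgn (pseries (expmx_coef A i j) s).
Proof.
have [M M0 AM] := norm_expr_mx_le A.
apply: normed_cvg; apply: series_le_cvg (is_cvg_series_exp_coeff (M * `|s|)).
- by move=> k /=; exact: normr_ge0.
- by move=> k; rewrite exp_coeff_ge0// mulr_ge0// ltW.
move=> k /=; rewrite /exp_coeff /expmx_coef /= normrM normrM normfV normr_nat.
rewrite exprMn normrX mulrAC [leRHS]mulrC -mulrA ler_wpM2l ?invr_ge0//.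
by rewrite mulrC ler_wpM2r// exprn_ge0.
Qed.

(* The library's exprZn needs a nontrivial ring, that is, a dimension of the form m.+1. *)
Lemma exprn_scalemx (R : realType) n (A : 'M[R]_n) s k :
  (s *: A) ^+ k = s ^+ k *: A ^+ k.
Proof.
elim: k => [|k IH]; first by rewrite !expr0 scale1r.
by rewrite !exprS IH -!mulmxE -scalemxAl -scalemxAr scalerA.
Qed.

Lemma expmxE (R : realType) n (A : 'M[R]_n) s i j :
  expmx (s *: A) i j = limn (pseries (expmx_coef A i j) s).
Proof.
have serE a b : (fun k => ([series k`!%:R^-1 *: (s *: A) ^+ k]_k : nat -> 'M[R]_n) k a b)
    = pseries (expmx_coef A a b) s.
  apply/funext => N; rewrite /pseries /series /= summxE; apply: eq_bigr => k _.
  by rewrite exprn_scalemx !mxE /expmx_coef mulrA mulrAC.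
rewrite /expmx; set u := (X in limn X).
have /cvg_mx_entries/cvg_lim : forall a b, cvgn (fun k => u k a b).
  by move=> a b; rewrite serE; exact: is_cvg_expmx_coef.
by move=> -> //; rewrite mxE serE.
Qed.

Lemma expmx0 (R : realType) n : expmx (0 : 'M[R]_n) = 1%:M.
Proof.
apply/matrixP => i j; rewrite -(scale0r (0 : 'M[R]_n)) expmxE.
(* The partial sum at [N = 0] is empty; from [N = 1] on only the term of order 0 contributes. *)
have -> : pseries (expmx_coef 0 i j) (0 : R) = fun N => (0 < N)%:R * (i == j)%:R.
  apply/funext => -[|N]; rewrite /pseries /series /=; first by rewrite big_nil mul0r.
  rewrite big_nat_recl// expr0 mulr1 /expmx_coef expr0 mxE fact0 invr1 mul1r big1.
    by rewrite addr0.
  by move=> k _; rewrite [X in _ * X]expr0n mulr0.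
rewrite mxE; apply: cvg_lim => //; apply: cvg_near_cst.
by near=> N; rewrite (_ : (0 < N)%N) ?mul1r//; near: N; exact: nbhs_infty_gt.
Unshelve. all: by end_near. Qed.

Lemma trmx_exprn (R : realType) n (A : 'M[R]_n) k : (A ^+ k)^T = A^T ^+ k.
Proof.
elim: k => [|k IH]; first by rewrite !expr0 trmx1.
by rewrite exprS exprSr -!mulmxE trmx_mul IH.
Qed.

Lemma trmx_expmx (R : realType) n (A : 'M[R]_n) s :
  (expmx (s *: A))^T = expmx (s *: A^T).
Proof.
apply/matrixP => i j; rewrite mxE !expmxE; congr (limn (pseries _ _)).
by apply/funext => k; rewrite /expmx_coef -trmx_exprn mxE.
Qed.

Lemma is_derive_expmx (R : realType) n (A : 'M[R]_n) i j (s : R) :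
  is_derive s 1 (fun s => expmx (s *: A) i j) ((A *m expmx (s *: A)) i j).
Proof.
have -> : (fun s => expmx (s *: A) i j) = fun s => limn (pseries (expmx_coef A i j) s).
  by apply/funext => t; rewrite expmxE.
(* Used twice, with [c] a row of [A] and a row of [A *m A]: these give the first and second formal
   derivatives. *)
have cvgS (c : 'I_n -> R) (x : R) :
    (pseries (fun k => \sum_l c l * expmx_coef A l j k) x @ \oo -->
     \sum_l c l * limn (pseries (expmx_coef A l j) x))%classic.
  have -> : pseries (fun k => \sum_l c l * expmx_coef A l j k) x =
      fun N => \sum_l c l * pseries (expmx_coef A l j) x N.
    apply/funext => N; rewrite /pseries /series /=.
    under [RHS]eq_bigr do rewrite mulr_sumr.
    rewrite exchange_big; apply: eq_bigr => k _; rewrite mulr_suml.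
    by apply: eq_bigr => q _; rewrite mulrA.
  apply: cvg_big => [|q _]; first exact: add_continuous.
  by apply: cvgMl_tmp; exact: is_cvg_expmx_coef.
have diffs2 : pseries_diffs (pseries_diffs (expmx_coef A i j)) =
    fun k => \sum_l (A *m A) i l * expmx_coef A l j k.
  apply/funext => k; rewrite {1}/pseries_diffs pseries_diffs_expmx_coef mulr_sumr.
  under eq_bigr => l _.
    rewrite mulrCA.
    have -> : k.+1%:R * expmx_coef A l j k.+1 = pseries_diffs (expmx_coef A l j) k by [].
    rewrite pseries_diffs_expmx_coef mulr_sumr; over.
  rewrite exchange_big; apply: eq_bigr => l _; rewrite mxE mulr_suml.
  by apply: eq_bigr => q _; rewrite mulrA.
(* Termwise differentiation at [s] asks for convergence at some point of larger modulus; [|s| + 1]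
   serves. *)
have sK : `|s| < `| `|s| + 1 | by rewrite [ltRHS]ger0_norm ?addr_ge0// ltrDl.
have := pseries_snd_diffs (@is_cvg_expmx_coef _ _ A i j (`|s| + 1)) _ _ sK.
rewrite diffs2 pseries_diffs_expmx_coef.
move=> /(_ (cvgP _ (cvgS _ _)) (cvgP _ (cvgS _ _))).
rewrite (cvg_lim _ (cvgS _ _))// mxE.
by under eq_bigr do rewrite -expmxE.
Qed.

(** * Taylor polynomials and the Hilbert matrix *)

(** [G - H] has a nonnegative derivative. Integrals are handled below as increments of primitives,
    and this lemma plays the part of monotonicity of the integral. *)
Lemma le_increment (R : realType) (g h G H : R -> R) (a b : R) :
  a <= b -> (forall s, a <= s <= b -> is_derive s 1 G (g s)) ->
  (forall s, a <= s <= b -> is_derive s 1 H (h s)) ->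
  (forall s, a <= s <= b -> h s <= g s) -> H b - H a <= G b - G a.
Proof.
move=> ab dG dH hg.
have dF s : a <= s <= b -> is_derive s 1 (G - H) (g s - h s).
  by move=> sab; apply: is_deriveB; [exact: dG|exact: dH].
suff : (G - H) a <= (G - H) b by rewrite !fctE; lra.
apply: (@ger0_derive1_le_cc _ _ a b); rewrite ?in_itv/= ?lexx ?ab//.
- move=> s; rewrite in_itv/= => /andP[/ltW sa /ltW sb].
  have sab : a <= s <= b by rewrite sa.
  by have [] := dF s sab.
- move=> s; rewrite in_itv/= => /andP[/ltW sa /ltW sb].
  have sab : a <= s <= b by rewrite sa.
  by have := dF s sab => dFs; rewrite derive1E derive_val subr_ge0 hg.
- by apply: derivable_within_continuous => s; rewrite in_itv/= => /dF[].
Qed.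

(** Induction on the order: the family shifted by one satisfies the bound, and integrating that
    bound yields the next order. The usual factor [1 / N!] is given up. *)
Lemma taylor_le (R : realType) N (f : nat -> R -> R) (M T : R) :
  (forall k (s : R), is_derive s 1 (f k) (f k.+1 s)) ->
  (forall s, 0 <= s <= T -> `|f N s| <= M) ->
  forall t, 0 <= t <= T ->
    `|f 0%N t - (\poly_(k < N) (k`!%:R^-1 * f k 0)).[t]| <= M * t ^+ N.
Proof.
elim: N f => [|N IH] f df fM t t0T.
  by rewrite expr0 mulr1 poly_def big_ord0 horner0 subr0; exact: fM.
have {}IH := IH (fun k => f k.+1) (fun k => df k.+1) fM.
set p := \poly_(k < N.+1) _; pose q := \poly_(k < N) (k`!%:R^-1 * f k.+1 0).
have dp : p^`() = q.
  apply/polyP => k; rewrite coef_deriv !coef_poly ltnS; case: ifP => _; last by rewrite mul0rn.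
  rewrite factS natrM invfM -mulrnAl; congr (_ * _).
  by rewrite mulrC -mulrnAr -[X in _ * X]mulr_natl mulfV ?mulr1// pnatr_eq0.
have p0 : p.[0] = f 0%N 0.
  by rewrite horner_coef0 coef_poly /= fact0 invr1 mul1r.
have M0 : 0 <= M.
  have /andP[t0 tT] := t0T.
  by apply: le_trans (fM 0 _); rewrite ?lexx ?(le_trans t0 tT).
have /andP[t0 tT] := t0T.
have dF s : 0 <= s <= t -> is_derive s 1 (f 0%N - horner p) (f 1%N s - q.[s]).
  by move=> _; apply: is_deriveB; rewrite -dp; exact: is_derive_poly.
pose m : {poly R} := M *: 'X^(N.+1).
have dm s : 0 <= s <= t -> is_derive s 1 (horner m) (M * N.+1%:R * s ^+ N).
  move=> _; apply: is_derive_eq.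
  by rewrite /m derivZ derivXn /= hornerZ hornerMn hornerXn -mulr_natl mulrA.
(* The spare factor [N.+1] makes the right-hand side the exact derivative of [m]. *)
have mge s : 0 <= s <= t -> `|f 1%N s - q.[s]| <= M * N.+1%:R * s ^+ N.
  move=> /andP[s0 st]; apply: le_trans (IH s _) _.
    by rewrite s0 (le_trans st).
  rewrite ler_wpM2r ?exprn_ge0// ler_peMr// ler1n //.
have m0 : m.[0] = 0 by rewrite hornerZ hornerXn expr0n mulr0.
have mt : m.[t] = M * t ^+ N.+1 by rewrite hornerZ hornerXn.
rewrite ler_norml; apply/andP; split.
- have := le_increment t0 dF (fun s st => is_deriveN (dm s st)) _.
  rewrite !fctE m0 mt p0 subrr ?(oppr0, subr0, addr0); apply => s st.
  by have := mge s st; rewrite ler_norml => /andP[].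
have := le_increment t0 dm dF _.
rewrite !fctE m0 mt p0 subrr ?(oppr0, subr0, addr0); apply => s st.
by have := mge s st; rewrite ler_norml => /andP[].
Qed.

(** The antiderivative, vanishing at 0, of the square of the polynomial with coefficients [c],
    expanded so that the entries of the Hilbert matrix show up. *)
Definition sqr_primitive (R : realType) N (c : 'I_N -> R) : {poly R} :=
  \sum_i \sum_j (c i * c j / (i + j).+1%:R) *: 'X^((i + j).+1).

Definition hilbert_mx (R : realType) N : 'M[R]_N := \matrix_(i, j) (i + j).+1%:R^-1.

Lemma deriv_sqr_primitive (R : realType) N (c : 'I_N -> R) :
  (sqr_primitive c)^`() = (\sum_i c i *: 'X^i) ^+ 2.
Proof.
rewrite expr2 mulr_suml /sqr_primitive raddf_sum; apply: eq_bigr => i _.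
rewrite raddf_sum mulr_sumr; apply: eq_bigr => j _ /=.
rewrite derivZ derivXn /= -[RHS]scalerAl -[in RHS]scalerAr [RHS]scalerA.
by rewrite -exprD -['X^_ *+ _]scaler_nat scalerA mulfVK// pnatr_eq0.
Qed.

Lemma horner_sqr_primitive (R : realType) N (c : 'I_N -> R) t :
  (sqr_primitive c).[t] = t * quad_form (hilbert_mx R N) (\col_i (c i * t ^+ i)).
Proof.
rewrite quad_form_sum horner_sum mulr_sumr; apply: eq_bigr => i _.
rewrite horner_sum mulr_sumr; apply: eq_bigr => j _.
by rewrite hornerZ hornerXn !mxE exprS exprD; ring.
Qed.

Lemma sqr_primitive0 (R : realType) N (c : 'I_N -> R) : (sqr_primitive c).[0] = 0.
Proof. by rewrite horner_sqr_primitive mul0r. Qed.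

(** The form at [x] is the integral over [[0, 1]] of the square of the polynomial with coefficients
    [x]. If it is not positive, the nondecreasing primitive [P] vanishes on [[0, 1]], hence
    identically, and so does its derivative, the square. *)
Lemma hilbert_pd (R : realType) N : sym_pd (hilbert_mx R N).
Proof.
split=> [|x x0]; first by apply/matrixP => i j; rewrite !mxE addnC.
pose c i := x i 0; pose P := sqr_primitive c.
have PE : P.[1] = quad_form (hilbert_mx R N) x.
  rewrite horner_sqr_primitive mul1r; congr quad_form.
  by apply/matrixP => i j; rewrite mxE expr1n mulr1 ord1.
rewrite -PE ltNge; apply: contraNN x0 => P1.
have Pmono a b : 0 <= a -> a <= b -> P.[a] <= P.[b].
  move=> a0 ab; rewrite -subr_ge0.
  have := @le_increment R _ _ _ (cst 0) a b ab
    (fun s _ => is_derive_poly P s) (fun s _ => is_derive_cst 0 s 1).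
  rewrite [cst 0 b - _]subrr; apply => s _.
  by rewrite deriv_sqr_primitive horner_exp sqr_ge0.
have P0 a : 0 <= a <= 1 -> P.[a] = 0.
  move=> /andP[a0 a1]; apply/eqP; rewrite eq_le (le_trans (Pmono _ _ a0 a1) P1).
  by rewrite -(sqr_primitive0 c) Pmono.
have {}P0 : P = 0.
  apply/eqP/negPn/negP => Pn0.
  (* The points [1 / (k + 1)] are [size P] distinct roots, one more than the degree of [P]
     allows. *)
  pose s : seq R := [seq k.+1%:R^-1 | k <- iota 0 (size P)].
  have := @max_poly_roots _ P s Pn0; rewrite size_map size_iota ltnn => H.
  suff : false by []. apply: H.
    apply/allP => _ /mapP[k _ ->]; apply/eqP/P0.
    by rewrite invr_ge0 ler0n invf_le1// ler1n.
  rewrite map_inj_uniq ?iota_uniq// => k l /invr_inj/eqP.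
  by rewrite eqr_nat => /eqP[].
have : (\sum_i c i *: 'X^i : {poly R}) == 0.
  by rewrite -sqrf_eq0 -deriv_sqr_primitive -/P P0 deriv0.
move=> /eqP/polyP c0; apply/eqP/matrixP => i j; rewrite ord1 !mxE -/(c i).
have := c0 i; rewrite coef_sum coef0 (bigD1 i)//= coefZ coefXn eqxx mulr1.
rewrite big1 ?addr0// => k ki; rewrite coefZ coefXn eq_sym.
by rewrite -(inj_eq val_inj) in ki; rewrite (negPf ki) mulr0.
Qed.

(** The constant is the coercivity constant of the Hilbert matrix and depends on [N] alone.
    Rescaling [[0, t]] to [[0, 1]] produces the odd exponents that make up the local homogeneous
    dimension. *)
Lemma sqr_primitive_ge (R : realType) N : exists2 k : R, 0 < k &
  forall (c : 'I_N -> R) t, 0 <= t ->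
    k * \sum_i c i ^+ 2 * t ^+ i.*2.+1 <= (sqr_primitive c).[t].
Proof.
have [k k0 Hk] := sym_pd_coercive (@hilbert_pd R N); exists k => // c t t0.
rewrite horner_sqr_primitive; apply: le_trans (ler_wpM2l t0 (Hk _)).
rewrite le_eqVlt mulrCA !mulr_sumr; apply/orP; left; apply/eqP/eq_bigr => i _.
by rewrite mxE [t ^+ _.+1]exprS -muln2 exprM; ring.
Qed.

(** * Primitives and the Gramian *)

Lemma continuous_mulmx_entry (R : realType) m n p (M : R -> 'M[R]_(m, n))
    (N : R -> 'M[R]_(n, p)) i j :
  (forall a b, continuous (fun s => M s a b)) ->
  (forall a b, continuous (fun s => N s a b)) ->
  continuous (fun s => (M s *m N s) i j).
Proof.
move=> cM cN; have -> : (fun s => (M s *m N s) i j) = fun s => \sum_k M s i k * N s k j.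
  by apply/funext => s; rewrite mxE.
move=> s; apply: cvg_big => [|k _]; first exact: add_continuous.
by apply: cvgM; [exact: cM|exact: cN].
Qed.

Definition primitive (R : realType) (g G : R -> R) :=
  forall s : R, 0 <= s -> is_derive s 1 G (g s).

(* Integrating from -1 rather than 0 makes the primitive differentiable at 0. *)
Lemma integral_primitive (R : realType) (f : R -> R) : continuous f ->
  exists2 G : R -> R, primitive f G & forall t, 0 <= t ->
    (\int[lebesgue_measure]_(s in `[0%R, t]%classic) f s) = G t - G 0.
Proof.
move=> cf; pose G t := \int[lebesgue_measure]_(s in `[(- 1)%R, t]%classic) f s.
have fint a b : lebesgue_measure.-integrable `[a, b]%classic (EFin \o f).
  apply: continuous_compact_integrable; first exact: segment_compact.
  exact: continuous_subspaceT.
exists G => [s s0|t t0].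
  have s1 : s < s + 1 by rewrite ltrDl.
  have [|dG dGE] := @continuous_FTC1_closed R f (-1) s (s + 1) s1 (fint _ _) _ (cf s).
    by rewrite (lt_le_trans _ s0)// ltrN10.
  by apply: DeriveDef => //; rewrite -derive1E.
(* The difference of the two integrals is over []0, t]]; adding the endpoint 0 does not change
   it. *)
rewrite /G Rintegral_itvB ?bnd_simp ?lerN10//.
rewrite Rintegral_itv_obnd_cbnd//.
by apply: integrableS (fint 0 t) => //; exact: subset_itv_oc_cc.
Qed.

Lemma is_derive_sumE (R : realType) (n : nat) (f : 'I_n -> R -> R) (df : 'I_n -> R) (s : R) :
  (forall i, is_derive s 1 (f i) (df i)) ->
  is_derive s 1 (fun t => \sum_i f i t) (\sum_i df i).
Proof.
move=> Hf; have -> : (fun t => \sum_i f i t) = \sum_i f i.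
  by apply/funext => t; rewrite fct_sumE.
exact: is_derive_sum.
Qed.

Lemma is_derive_cstM (R : realType) (c : R) (f : R -> R) (df s : R) :
  is_derive s 1 f df ->
  is_derive s 1 (fun t => c * f t) (c * df).
Proof. by move=> Hf; exact: is_deriveZ. Qed.

(** The transpose of [exp(s B^T)] is [exp(sB)], so the integrand of the Gramian, taken as a form at
    [x], is the form of [Q] along a solution of [y' = B^T y]. *)
Lemma primitive_gramian (R : realType) n (Q B : 'M[R]_n) (x : 'cV[R]_n) :
  exists2 G : R -> R, primitive (fun s => quad_form Q (expmx (s *: B^T) *m x)) G &
    forall t, 0 <= t -> quad_form (gramian Q B t) x = G t - G 0.
Proof.
pose M s := expmx (s *: B) *m Q *m expmx (s *: B^T).
have cexp (A : 'M[R]_n) a b : continuous (fun s : R => expmx (s *: A) a b).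
  move=> s; apply/differentiable_continuous/derivable1_diffP.
  by have [] := is_derive_expmx A a b s.
have cM i j : continuous (fun s => M s i j).
  apply: continuous_mulmx_entry => a b; last exact: cexp.
  by apply: continuous_mulmx_entry => c d; [exact: cexp|exact: cst_continuous].
have /choice[G HG] (ij : 'I_n * 'I_n) : exists G,
    primitive (fun s => M s ij.1 ij.2) G /\ forall t, 0 <= t ->
    (\int[lebesgue_measure]_(s in `[0%R, t]%classic) M s ij.1 ij.2) = G t - G 0.
  by have [G] := integral_primitive (cM ij.1 ij.2); exists G.
exists (fun t => \sum_i \sum_j x i 0 * x j 0 * G (i, j) t) => [s s0|t t0].
  have -> : quad_form Q (expmx (s *: B^T) *m x) =
      \sum_i \sum_j x i 0 * x j 0 * M s i j.
    have -> : quad_form Q (expmx (s *: B^T) *m x) = quad_form (M s) x.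
      by rewrite /quad_form /M trmx_mul trmx_expmx trmxK !mulmxA.
    rewrite quad_form_sum; apply: eq_bigr => i _; apply: eq_bigr => j _; ring.
  apply: is_derive_sumE => i; apply: is_derive_sumE => j.
  by apply: is_derive_cstM; exact: (proj1 (HG (i, j))).
rewrite quad_form_sum -sumrB; apply: eq_bigr => i _.
rewrite -sumrB; apply: eq_bigr => j _.
by rewrite mxE (proj2 (HG (i, j)) t t0)/=; ring.
Qed.

(** * Solutions of y' = A y *)

Definition solution (R : realType) n (A : 'M[R]_n) (y : R -> 'cV[R]_n) :=
  forall (s : R) i, is_derive s 1 (fun t => y t i 0) ((A *m y s) i 0).

Lemma solution_mulmx (R : realType) m n (A : 'M[R]_n) y (M : 'M[R]_(m, n)) (s : R) i :
  solution A y -> is_derive s 1 (fun t => (M *m y t) i 0) ((M *m (A *m y s)) i 0).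
Proof.
move=> ysol; rewrite mxE.
have -> : (fun t => (M *m y t) i 0) = fun t => \sum_j M i j * y t j 0.
  by apply/funext => t; rewrite mxE.
by apply: is_derive_sumE => j; apply: is_derive_cstM.
Qed.

Lemma solution_expmx (R : realType) n (A : 'M[R]_n) (x : 'cV[R]_n) :
  solution A (fun s => expmx (s *: A) *m x).
Proof.
move=> s i; rewrite mulmxA mxE.
have -> : (fun t => (expmx (t *: A) *m x) i 0) =
    fun t => \sum_j x j 0 * expmx (t *: A) i j.
  by apply/funext => t; rewrite mxE; apply: eq_bigr => j _; rewrite mulrC.
under eq_bigr do rewrite mulrC.
by apply: is_derive_sumE => j; apply: is_derive_cstM; exact: is_derive_expmx.
Qed.

Lemma is_derive_translate (R : realType) (f : R -> R) (df a s : R) :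
  is_derive (a + s) 1 f df -> is_derive s 1 (fun t => f (a + t)) df.
Proof.
move=> Hf; have -> : (fun t => f (a + t)) = f \o shift a.
  by apply/funext => t /=; rewrite addrC.
have Ha : is_derive s 1 (shift a) 1 by exact: is_derive_shift.
by rewrite -[df]mulr1; apply: is_derive1_comp; rewrite /= addrC.
Qed.

Lemma solution_translate (R : realType) n (A : 'M[R]_n) y a :
  solution A y -> solution A (fun s => y (a + s)).
Proof. by move=> ysol s i; exact: is_derive_translate (ysol _ _). Qed.

(** [z = W y] solves [z' = S z], and the derivative of its squared norm is [2 z^T S z], which
    vanishes: a 1 x 1 matrix equal to the opposite of its transpose is zero. *)
Lemma skew_energy (R : realType) n (A W S : 'M[R]_n) y s :
  S^T = - S -> W *m A = S *m W -> solution A y ->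
  \sum_i (W *m y s) i 0 ^+ 2 = \sum_i (W *m y 0) i 0 ^+ 2.
Proof.
move=> Sskew WA ysol; pose z t := W *m y t.
apply: (@is_derive_0_is_cst R (fun t => \sum_i z t i 0 ^+ 2)) => t.
have zSz : \sum_i z t i 0 * (S *m z t) i 0 = 0.
  suff H : (z t)^T *m (S *m z t) = 0.
    transitivity (((z t)^T *m (S *m z t)) 0 0); last by rewrite H mxE.
    by rewrite [RHS]mxE; apply: eq_bigr => i _; rewrite [in RHS]mxE.
  move: (z t) => v; have : (v^T *m (S *m v))^T = - (v^T *m (S *m v)).
    by rewrite !trmx_mul trmxK Sskew mulmxN mulNmx -mulmxA.
  move=> /matrixP H; apply/matrixP => i j; rewrite !ord1.
  by have := H 0 0; rewrite !mxE; lra.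
have dz i : is_derive t 1 (fun s => z s i 0 ^+ 2)
    (z t i 0 * (S *m z t) i 0 + z t i 0 * (S *m z t) i 0).
  have dz : is_derive t 1 (fun s => z s i 0) ((S *m z t) i 0).
    by rewrite /z mulmxA -WA -mulmxA; exact: solution_mulmx.
  by have := is_deriveM dz dz; congr is_derive; apply/funext => ?; rewrite expr2.
by have := is_derive_sumE dz; rewrite big_split /= zSz addr0.
Qed.

(** Invertibility of [W] makes the conserved energy comparable with the squared norm, so the norms
    at any two times are comparable. *)
Lemma skew_solution_bounds (R : realType) n (A W S : 'M[R]_n) :
  W \in unitmx -> S^T = - S -> W *m A = S *m W ->
  exists2 K, 0 < K & forall y s, solution A y ->
    \sum_i y s i 0 ^+ 2 <= K * \sum_i y 0 i 0 ^+ 2 /\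
    \sum_i y 0 i 0 ^+ 2 <= K * \sum_i y s i 0 ^+ 2.
Proof.
move=> Wu Sskew WA; have [C C0 HC] := sqnorm_mulmx_le W.
have [C' C'0 HC'] := sqnorm_mulmx_le (invmx W).
exists (C' * C); first exact: mulr_gt0.
suff H y s s' : solution A y -> \sum_i y s i 0 ^+ 2 <= C' * C * \sum_i y s' i 0 ^+ 2.
  by move=> y s ysol; split; exact: H.
move=> ysol; have := HC' (W *m y s); rewrite mulKmx// => /le_trans; apply.
rewrite -mulrA ler_wpM2l ?(ltW C'0)// (skew_energy s Sskew WA ysol).
by rewrite -(skew_energy s' Sskew WA ysol).
Qed.

(* The first nu.+1 Taylor coefficients (A ^+ k *m x) i 0 of the observed coordinates
   control all of x; the remainder is of higher order. *)
Lemma small_time (R : realType) n nu (beta : 'I_n -> nat) (A Q : 'M[R]_n) (q K : R) :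
  (forall i, beta i <= nu)%N ->
  0 < q ->
  (forall x : 'cV_n, q * \sum_(i | beta i == 0%N) x i 0 ^+ 2 <= quad_form Q x) ->
  (forall i, exists2 C, 0 < C & forall x : 'cV_n,
    x i 0 ^+ 2 <=
    C * \sum_(k < (beta i).+1) \sum_(l | beta l == 0%N) (A ^+ k *m x) l 0 ^+ 2) ->
  0 < K ->
  (forall y s, solution A y -> \sum_i y s i 0 ^+ 2 <= K * \sum_i y 0 i 0 ^+ 2) ->
  exists t0 c, [/\ 0 < t0 <= 1, 0 < c & forall y G t, solution A y ->
    primitive (fun s => quad_form Q (y s)) G -> 0 <= t <= t0 ->
    c * \sum_i t ^+ (beta i).*2.+1 * y 0 i 0 ^+ 2 <= G t - G 0].
Proof.
move=> beta_nu q0 HQ HA K0 HK.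
pose N := nu.+1.
have [k k0 Hk] := sqr_primitive_ge R N.
have [C C0 HC] := sqnorm_mulmx_le (A ^+ N).
have /choice[a Ha] i : exists a, 0 < a /\ forall x : 'cV_n,
    x i 0 ^+ 2 <= a * \sum_(k < (beta i).+1) \sum_(l | beta l == 0%N) (A ^+ k *m x) l 0 ^+ 2.
  by have [a] := HA i; exists a.
pose a1 := 1 + \sum_i a i.
have a10 : 0 < a1 by rewrite ltr_pwDl// sumr_ge0// => i _; have [/ltW] := Ha i.
(* [c1] gathers the losses of the main term: [q / 2] from comparing squares, [k] from the Hilbert
   matrix, the square of [nu!] from the Taylor coefficients, [a1] from recovering [y 0] out of
   them. *)
have [c1 c1E c10] : exists2 c1, c1 = q / 2 * k / (nu`!%:R ^+ 2) / a1 & 0 < c1.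
  eexists; first by [].
  have qk : 0 < q / 2 * k by rewrite mulr_gt0// divr_gt0.
  have fn : 0 < nu`!%:R ^+ 2 :> R by rewrite exprn_gt0// ltr0n fact_gt0.
  by rewrite !divr_gt0.
(* [c2] bounds the Taylor remainders of at most [n] observed coordinates, each with constant
   [C * K]. *)
have [c2 c2E c20] : exists2 c2, c2 = q * n%:R * (C * K) & 0 <= c2.
  by eexists; [by []|rewrite !mulr_ge0 ?ler0n// ltW].
(* Small enough for the remainder, which carries an extra power of [t], to use up at most half of
   the main term; the [+ 1] guards against [c2 = 0]. *)
pose t0 := Num.min 1 (c1 / (2 * (c2 + 1))).
have t00 : 0 < t0 by rewrite lt_min ltr01 divr_gt0// mulr_gt0// ltr_wpDl.
have t01 : t0 <= 1 by rewrite ge_min lexx.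
exists t0, (c1 / 2); split; rewrite ?t00 ?divr_gt0// => y G t ysol dG /andP[tge0 tt0].
have t1 : t <= 1 by apply: le_trans t01.
set X := \sum_i y 0 i 0 ^+ 2.
have X0 : 0 <= X by rewrite sumr_ge0// => i _; exact: sqr_ge0.
have CKX : 0 <= C * K * X by rewrite !mulr_ge0// ltW.
pose f i k s := (A ^+ k *m y s) i 0.
have df i k' (s : R) : is_derive s 1 (f i k') (f i k'.+1 s).
  by rewrite /f exprSr -mulmxE -mulmxA; exact: solution_mulmx.
pose p i := \poly_(k < N) (k`!%:R^-1 * f i k 0).
have rem i s : 0 <= s <= t -> (f i 0%N s - (p i).[s]) ^+ 2 <= C * K * X * s ^+ N.*2.
  move=> st; have := @taylor_le R N (f i) (Num.sqrt (C * K * X)) t (df i) _ s st.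
  rewrite -/(p i) => H.
  have {}H : `|f i 0%N s - (p i).[s]| <= Num.sqrt (C * K * X) * s ^+ N.
    apply: H => s' _; rewrite -sqrtr_sqr; apply: ler_wsqrtr.
    apply: (@le_trans _ _ (\sum_i (A ^+ N *m y s') i 0 ^+ 2)).
      by rewrite (bigD1 i)//= lerDl sumr_ge0// => j _; exact: sqr_ge0.
    by apply: le_trans (HC _) _; rewrite -mulrA ler_wpM2l ?(ltW C0)// HK.
  rewrite -real_normK ?num_real// -muln2 exprM -[C * K * X]sqr_sqrtr// -exprMn.
  by rewrite ler_sqr ?nnegrE// mulr_ge0 ?sqrtr_ge0// exprn_ge0//; case/andP: st.
pose P i := @sqr_primitive R N (fun k => k`!%:R^-1 * f i k 0).
(* The derivative of [H] is a lower bound for the form along [y]: half the squared Taylor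
   polynomials minus the remainder. The factor [N.*2.+1] from differentiating the last monomial only
   helps. *)
pose H : {poly R} := (q / 2) *: \sum_(i | beta i == 0%N) P i - (c2 * X) *: 'X^(N.*2.+1).
have dH : H^`() = (q / 2) *: \sum_(i | beta i == 0%N) p i ^+ 2 -
    (c2 * X) *: ('X^(N.*2) *+ N.*2.+1).
  rewrite derivB !derivZ derivXn raddf_sum; congr (_ *: _ - _).
  by apply: eq_bigr => i _ /=; rewrite deriv_sqr_primitive /p poly_def.
have Hle s : 0 <= s <= t -> (H^`()).[s] <= quad_form Q (y s).
  move=> st; apply: le_trans (HQ _); rewrite dH hornerD hornerN !hornerZ.
  rewrite horner_sum hornerMn hornerXn.
  have s0 : 0 <= s by case/andP: st.
  have : c2 * X * s ^+ N.*2 <= c2 * X * (s ^+ N.*2 *+ N.*2.+1).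
    rewrite ler_wpM2l ?mulr_ge0// mulrS lerDl mulrn_wge0// exprn_ge0//.
  move=> c2X.
  have rsum : \sum_(i | beta i == 0%N) (f i 0%N s - (p i).[s]) ^+ 2 <=
      n%:R * (C * K * X * s ^+ N.*2).
    apply: (@le_trans _ _ (\sum_(i < n) C * K * X * s ^+ N.*2)); last first.
      by rewrite sumr_const card_ord mulr_natl.
    rewrite big_mkcond; apply: ler_sum => i _; case: ifP => _; first exact: rem.
    exact: mulr_ge0 CKX (exprn_ge0 _ s0).
  (* [p^2 / 2 <= y^2 + (y - p)^2], the difference being [(2 y - p)^2 / 2]. *)
  have fsum : 2^-1 * \sum_(i | beta i == 0%N) (p i ^+ 2).[s] <=
     \sum_(i | beta i == 0%N) y s i 0 ^+ 2 +
     \sum_(i | beta i == 0%N) (f i 0%N s - (p i).[s]) ^+ 2.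
    rewrite -big_split mulr_sumr; apply: ler_sum => i _ /=.
    rewrite horner_exp /f expr0 mul1mx.
    have := sqr_ge0 (2 * y s i 0 - (p i).[s]); nra.
  have := ler_wpM2l (ltW q0) fsum; have := ler_wpM2l (ltW q0) rsum.
  have -> : q * (n%:R * (C * K * X * s ^+ N.*2)) = c2 * X * s ^+ N.*2.
    by rewrite c2E; ring.
  rewrite [q * (2^-1 * _)]mulrA [q * (_ + _)]mulrDr.
  move: c2X; set r1 := c2 * X * (_ *+ _); set r2 := c2 * X * _.
  set r3 := q * \sum_(i | _) (_ - _) ^+ 2; set r4 := q / 2 * _; set r5 := q * _.
  lra.
have {}dG s : 0 <= s <= t -> is_derive s 1 G (quad_form Q (y s)).
  by case/andP => s0 _; exact: dG.
have := le_increment tge0 dG (fun s _ => is_derive_poly H s) Hle.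
have -> : H.[0] = 0.
  rewrite hornerD hornerN !hornerZ hornerXn expr0n mulr0 subr0 horner_sum big1 ?mulr0// => i _.
  exact: sqr_primitive0.
rewrite subr0; apply: le_trans.
rewrite hornerD hornerN !hornerZ hornerXn horner_sum.
set Z := \sum_i t ^+ _ * _.
(* As [t <= 1] and [beta i <= nu], the power [2 nu + 3] of the remainder can be lowered to
   [2 (beta i) + 2]. *)
have XZ : X * t ^+ N.*2.+1 <= t * Z.
  rewrite mulr_suml mulr_sumr; apply: ler_sum => i _.
  rewrite mulrC mulrA ler_wpM2r ?sqr_ge0// -exprS ler_wiXn2l//.
  by rewrite ltnS /N doubleS ltnW// !ltnS leq_double.
pose V k := \sum_(l | beta l == 0%N) (A ^+ k *m y 0) l 0 ^+ 2.
have V0 k' : 0 <= V k' by rewrite sumr_ge0// => l _; exact: sqr_ge0.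
set U := \sum_(k < N) t ^+ k.*2.+1 * V k.
have U0 : 0 <= U by rewrite sumr_ge0// => j _; rewrite mulr_ge0// exprn_ge0.
(* Coordinate [i] needs only the orders [j <= beta i], for which
   [t ^+ (beta i).*2.+1 <= t ^+ j.*2.+1]. *)
have ZU : Z <= a1 * U.
  apply: (@le_trans _ _ (\sum_i a i * U)); last first.
    by rewrite -mulr_suml ler_wpM2r// lerDr.
  apply: ler_sum => i _; have [ai0 /(_ (y 0))] := Ha i.
  move=> /(ler_wpM2l (exprn_ge0 (beta i).*2.+1 tge0))/le_trans; apply.
  rewrite mulrCA ler_wpM2l ?(ltW ai0)// mulr_sumr.
  have biN : ((beta i).+1 <= N)%N by rewrite ltnS.
  apply: (@le_trans _ _ (\sum_(j < (beta i).+1) t ^+ j.*2.+1 * V j)).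
    apply: ler_sum => j _; rewrite ler_wpM2r ?V0// ler_wiXn2l//.
    by rewrite ltnS leq_double -ltnS.
  rewrite /U (big_ord_widen _ (fun j => t ^+ j.*2.+1 * V j) biN) big_mkcond.
  apply: ler_sum => j _; case: ifP => _ //.
  by rewrite mulr_ge0// exprn_ge0.
have PU : k / nu`!%:R ^+ 2 * U <= \sum_(i | beta i == 0%N) (P i).[t].
  apply: (@le_trans _ _ (\sum_(i | beta i == 0%N)
      k * \sum_(j < N) (j`!%:R^-1 * f i j 0) ^+ 2 * t ^+ j.*2.+1)); last first.
    by apply: ler_sum => i _; exact: Hk.
  rewrite -mulr_sumr exchange_big -mulrA ler_wpM2l ?(ltW k0)// mulr_sumr.
  apply: ler_sum => j _; rewrite -mulr_suml mulrCA mulrC ler_wpM2r ?exprn_ge0//.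
  rewrite mulr_sumr; apply: ler_sum => i _; rewrite exprMn ler_wpM2r ?sqr_ge0//.
  rewrite -exprVn ler_sqr ?nnegrE ?invr_ge0//.
  by rewrite lef_pV2 ?posrE ?ltr0n ?fact_gt0// ler_nat; apply: leq_fact; rewrite -ltnS.
have c1Z : c1 * Z <= q / 2 * (k / nu`!%:R ^+ 2 * U).
  have -> : q / 2 * (k / nu`!%:R ^+ 2 * U) = c1 * (a1 * U).
    rewrite c1E; field.
    by rewrite gt_eqF//= pnatr_eq0 -lt0n fact_gt0.
  by rewrite ler_wpM2l// ltW.
have q20 : 0 <= q / 2 by rewrite divr_ge0 ?ltW.
have := ler_wpM2l q20 PU => PU2.
have c2t : c2 * t <= c1 / 2.
  apply: (@le_trans _ _ ((c2 + 1) * t0)).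
    by apply: ler_pM => //; rewrite lerDl.
  rewrite mulrC -ler_pdivlMr ?ltr_wpDl// ge_min; apply/orP; right.
  rewrite le_eqVlt; apply/orP; left; apply/eqP; field.
  by rewrite gt_eqF ?ltr_wpDl.
have Z0 : 0 <= Z.
  by rewrite sumr_ge0// => i _; exact: mulr_ge0 (exprn_ge0 _ tge0) (sqr_ge0 _).
have := ler_wpM2r Z0 c2t; have := ler_wpM2l c20 XZ.
rewrite -(mulrA c2 X) -(mulrA c2 t) => H1 H2.
set W := \sum_(i | _) _; rewrite -/W in PU2.
lra.
Qed.

(** * Lower bounds for the Gramian *)

Lemma primitive_translate (R : realType) (g G : R -> R) a : 0 <= a ->
  primitive g G -> primitive (fun s => g (a + s)) (fun s => G (a + s)).
Proof. by move=> a0 dG s s0; apply: is_derive_translate; apply: dG; exact: addr_ge0. Qed.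

Lemma primitive_nondecreasing (R : realType) (g G : R -> R) a b :
  primitive g G -> (forall s, 0 <= g s) -> 0 <= a <= b -> G a <= G b.
Proof.
move=> dG g0 /andP[a0 ab]; rewrite -subr_ge0.
have dG' s : a <= s <= b -> is_derive s 1 G (g s).
  by case/andP => sa _; apply: dG; exact: le_trans sa.
have := @le_increment R _ _ _ (cst 0) a b ab dG' (fun s _ => is_derive_cst 0 s 1).
by rewrite [cst 0 b - _]subrr; apply.
Qed.

(** [[0, t]] contains [m = floor(t / t0)] consecutive intervals of length [t0], each contributing at
    least [d]. Since [m >= 1], [t / t0 < m + 1 <= 2 m], whence the factor 2. *)
Lemma large_time (R : realType) (G : R -> R) (t0 d : R) : 0 < t0 -> 0 <= d ->
  (forall s t, 0 <= s <= t -> G s <= G t) ->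
  (forall s, 0 <= s -> d <= G (s + t0) - G s) ->
  forall t, t0 <= t -> d / (2 * t0) * t <= G t - G 0.
Proof.
move=> t00 d0 Gmono Gd t tt0.
have mt0 m : 0 <= m%:R * t0 by rewrite mulr_ge0// ltW.
have H m : m%:R * d <= G (m%:R * t0) - G 0.
  elim: m => [|m IH]; first by rewrite !mul0r subrr.
  by have := Gd _ (mt0 m); rewrite -natr1 !mulrDl !mul1r; lra.
have u0 : 0 <= t / t0 by rewrite divr_ge0// ?ltW// (lt_le_trans t00).
pose m := Num.truncn (t / t0).
have mt : m%:R * t0 <= t by rewrite -ler_pdivlMr// truncn_le.
have m1 : (1 <= m)%N by rewrite truncn_gt0 ler_pdivlMr// mul1r.
have tm : t / t0 <= 2 * m%:R.
  rewrite (le_trans (ltW (truncnS_gt _)))// -natrM ler_nat -/m mul2n -addnn -addn1.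
  by rewrite leq_add2l.
have := Gmono (m%:R * t0) t; rewrite mt mt0 => /(_ isT) Gmt.
apply: le_trans (lerB Gmt (lexx (G 0))); apply: le_trans (H m).
rewrite invfM [X in X * t](_ : _ = d / 2 / t0); last by rewrite mulrA.
by have := ler_wpM2l d0 tm; lra.
Qed.

Lemma gramian_ge (R : realType) n nu (beta : 'I_n -> nat) (B Q W S : 'M[R]_n) (q : R) :
  (forall i, beta i <= nu)%N -> 0 < q -> sym_psd Q ->
  (forall x : 'cV_n, q * \sum_(i | beta i == 0%N) x i 0 ^+ 2 <= quad_form Q x) ->
  (forall i, exists2 C, 0 < C & forall x : 'cV_n, x i 0 ^+ 2 <=
    C * \sum_(k < (beta i).+1) \sum_(l | beta l == 0%N) (B^T ^+ k *m x) l 0 ^+ 2) ->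
  W \in unitmx -> S^T = - S -> W *m B^T = S *m W ->
  exists t0 c, [/\ 0 < t0 <= 1, 0 < c,
    forall t (x : 'cV[R]_n), 0 <= t <= t0 ->
      c * \sum_i t ^+ (beta i).*2.+1 * x i 0 ^+ 2 <= quad_form (gramian Q B t) x &
    forall t (x : 'cV[R]_n), t0 <= t ->
      c * t * \sum_i x i 0 ^+ 2 <= quad_form (gramian Q B t) x].
Proof.
move=> beta_nu q0 [_ Qpsd] HQ HB Wu Sskew WB.
have [K K0 HK] := skew_solution_bounds Wu Sskew WB.
have [t0 [c [/andP[t00 t01] c0 Hc]]] := small_time beta_nu q0 HQ HB K0
  (fun y s ysol => proj1 (HK y s ysol)).
(* Gain over one interval [[s, s + t0]]: all weights are lowered to the smallest one,
   [t0 ^+ nu.*2.+1], and [K] brings the norm at time [s] back to time 0. *)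
pose d := c * t0 ^+ nu.*2.+1 / K.
have d0 : 0 < d by rewrite divr_gt0// mulr_gt0// exprn_gt0.
pose c' := Num.min c (d / (2 * t0)).
have sol0 (x : 'cV[R]_n) : expmx (0 *: B^T) *m x = x by rewrite scale0r expmx0 mul1mx.
exists t0, c'; split.
- by rewrite t00.
- by rewrite lt_min c0 divr_gt0// mulr_gt0.
- move=> t x /andP[tge0 tt0]; have [G dG ->//] := primitive_gramian Q B x.
  have := Hc _ _ t (solution_expmx B^T x) dG; rewrite tge0 tt0 sol0 => /(_ isT).
  apply: le_trans; rewrite ler_wpM2r ?ge_min ?lexx// sumr_ge0// => i _.
  exact: mulr_ge0 (exprn_ge0 _ tge0) (sqr_ge0 _).
move=> t x tt0; have [G dG ->] := primitive_gramian Q B x; last first.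
  by rewrite (le_trans _ tt0)// ltW.
have X0 : 0 <= \sum_i x i 0 ^+ 2 by rewrite sumr_ge0// => i _; exact: sqr_ge0.
set X := \sum_i _ in X0 *.
pose y s := expmx (s *: B^T) *m x; have ysol : solution B^T y := solution_expmx _ _.
have dX : 0 <= d * X by rewrite mulr_ge0// ltW.
have tge0 : 0 <= t by rewrite (le_trans _ tt0)// ltW.
apply: (@le_trans _ _ (d * X / (2 * t0) * t)).
  rewrite [leRHS](_ : _ = d / (2 * t0) * t * X); last by field; rewrite gt_eqF.
  by rewrite ler_wpM2r// ler_wpM2r// ge_min lexx orbT.
apply: large_time => // [s r sr|s s0].
  by apply: (primitive_nondecreasing dG) => // u; exact: Qpsd.
have := Hc _ _ t0 (solution_translate s ysol) (primitive_translate s0 dG).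
rewrite lexx ltW// addr0 => /(_ isT); apply: le_trans.
apply: (@le_trans _ _ (c * t0 ^+ nu.*2.+1 * \sum_i y s i 0 ^+ 2)).
  rewrite /d -[leLHS]mulrA ler_wpM2l//; first by rewrite mulr_ge0 ?exprn_ge0 ?ltW.
  rewrite mulrC ler_pdivrMr// mulrC; have [_] := HK y s ysol.
  by rewrite {1}/y sol0.
rewrite -mulrA ler_wpM2l ?(ltW c0)// mulr_sumr; apply: ler_sum => i _.
rewrite ler_wpM2r ?sqr_ge0// ler_wiXn2l ?(ltW t00)//.
by rewrite ltnS leq_double.
Qed.

Lemma det_gramian_ge (R : realType) n nu (beta : 'I_n -> nat) (B Q W S : 'M[R]_n) (q : R) :
  (forall i, beta i <= nu)%N -> 0 < q -> sym_psd Q ->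
  (forall x : 'cV_n, q * \sum_(i | beta i == 0%N) x i 0 ^+ 2 <= quad_form Q x) ->
  (forall i, exists2 C, 0 < C & forall x : 'cV_n, x i 0 ^+ 2 <=
    C * \sum_(k < (beta i).+1) \sum_(l | beta l == 0%N) (B^T ^+ k *m x) l 0 ^+ 2) ->
  W \in unitmx -> S^T = - S -> W *m B^T = S *m W ->
  exists2 gamma, 0 < gamma & forall t, 0 < t ->
    gamma * Num.min (t ^+ \sum_i (beta i).*2.+1) (t ^+ n) <= volume Q B t.
Proof.
move=> beta_nu q0 Qpsd HQ HB Wu Sskew WB.
have [t0 [c [/andP[t00 t01] c0 Hsmall Hlarge]]] :=
  gramian_ge beta_nu q0 Qpsd HQ HB Wu Sskew WB.
have Gsym t : (gramian Q B t)^T = gramian Q B t.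
  apply/matrixP => i j; rewrite !mxE; congr Rintegral; apply/funext => s.
  have H : (expmx (s *: B) *m Q *m expmx (s *: B^T))^T =
      expmx (s *: B) *m Q *m expmx (s *: B^T).
    by rewrite !trmx_mul !trmx_expmx trmxK (proj1 Qpsd) mulmxA.
  by rewrite -[in RHS]H [RHS]mxE.
(* The diagonal comparison matrices have entries [c * t ^+ (beta i).*2.+1] up to [t0] and [c * t]
   beyond; both determinants carry the factor [c ^+ n]. *)
exists (c ^+ n) => [|t tgt0]; first exact: exprn_gt0.
have [tt0|/ltW tt0] := leP t t0.
  have := @prod_le_det R n (gramian Q B t) (fun i => c * t ^+ (beta i).*2.+1) (Gsym t).
  rewrite big_split /= prodr_const card_ord prodrXr => H.
  apply: le_trans (H _ _); last 2 first.
  - by move=> i; rewrite mulr_gt0// exprn_gt0.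
  - move=> x; under eq_bigr do rewrite -mulrA; rewrite -mulr_sumr.
    by apply: Hsmall; rewrite tt0 ltW.
  by rewrite ler_wpM2l ?exprn_ge0 ?(ltW c0)// ge_min lexx.
have := @prod_le_det R n (gramian Q B t) (fun i => c * t) (Gsym t).
rewrite prodr_const card_ord exprMn => H; apply: le_trans (H _ _); last 2 first.
- by move=> i; rewrite mulr_gt0.
- by move=> x; rewrite -mulr_sumr; exact: Hlarge.
by rewrite ler_wpM2l ?exprn_ge0 ?(ltW c0)// ge_min lexx orbT.
Qed.

(** * Blocks *)

Import tagnat.

Lemma sum_tagnat (V : nmodType) m (p : 'I_m -> nat) (f : 'I_(\sum_i p i) -> V) :
  \sum_s f s = \sum_l \sum_(r < p l) f (Rank l r).
Proof.
rewrite sig_big_dep /= (reindex _ sig_bij_on)/=.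
by apply: eq_bigr => s _; rewrite -[in LHS](sig2K s).
Qed.

Lemma sum_tagnat_block (V : nmodType) m (p : 'I_m -> nat) (f : 'I_(\sum_i p i) -> V) j :
  \sum_(s | sig1 s == j) f s = \sum_(r < p j) f (Rank j r).
Proof.
rewrite big_mkcond sum_tagnat (bigD1 j)//= [X in _ + X]big1 ?addr0 => [|l lj].
  by apply: eq_bigr => r _; rewrite Rank1K eqxx.
by apply: big1 => r _; rewrite Rank1K (negPf lj).
Qed.

(* The rows of the subdiagonal block B_j are independent, so the block j of y can be
   read off from the block j - 1 of B^T *m y once the blocks before j are known. *)
Lemma block_step (R : realType) m (p : 'I_m -> nat) (B : 'M[R]_(\sum_i p i)) (j j' : 'I_m) :
  j = j'.+1 :> nat -> \rank (submxblock B j j') = p j ->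
  (forall i : 'I_m, (j < i)%N -> submxblock B i j' = 0) ->
  exists2 C, 0 < C & forall y : 'cV_(\sum_i p i),
    \sum_(s | sig1 s == j) y s 0 ^+ 2 <=
    C * (\sum_(s | sig1 s == j') (B^T *m y) s 0 ^+ 2 +
         \sum_(s | (sig1 s < j)%N) y s 0 ^+ 2).
Proof.
move=> jj' rkM B0; pose M := submxblock B j j'.
have /row_freeP[G MG] : row_free M by rewrite /row_free rkM.
have [C C0 HC] := sqnorm_mulmx_le G^T.
have [C' C'0 HC'] := sqnorm_mulmx_le B^T.
(* [C] bounds the left inverse [G^T] of [M^T], the 2 comes from [(a - b)^2 <= 2 a^2 + 2 b^2], and
   [C'] bounds the contribution of the earlier blocks. *)
exists (C * (2 + 2 * C')) => [|y]; first by rewrite mulr_gt0// addr_gt0// mulr_gt0.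
pose z := submxcol y j.
(* [u] is the part of [y] in the blocks before [j]. In [y - u] only block [j] reaches block [j'] of
   the image under [B^T], as the later blocks meet zero blocks of [B]. *)
pose u : 'cV[R]_(\sum_i p i) := \col_s (if (sig1 s < j)%N then y s 0 else 0).
have Mz r : (M^T *m z) r 0 = (B^T *m (y - u)) (Rank j' r) 0.
  rewrite !mxE sum_tagnat (bigD1 j)//= [X in _ = _ + X]big1 ?addr0 => [|l lj].
    by apply: eq_bigr => r' _; rewrite !mxE Rank1K ltnn subr0.
  apply: big1 => r' _; rewrite !mxE Rank1K; case: ltngtP lj => [_|jl _|/val_inj e /eqP[]//].
  - by rewrite subrr mulr0.
  - by have /matrixP/(_ r' r) := B0 l jl; rewrite !mxE => ->; rewrite mul0r.
have zE : z = G^T *m (M^T *m z) by rewrite mulmxA -trmx_mul MG trmx1 mul1mx.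
rewrite !sum_tagnat_block.
have -> : \sum_(r < p j) y (Rank j r) 0 ^+ 2 = \sum_r z r 0 ^+ 2.
  by apply: eq_bigr => r _; rewrite mxE.
rewrite zE; apply: le_trans (HC _) _; rewrite -mulrA ler_wpM2l ?(ltW C0)//.
have -> : \sum_i (M^T *m z) i 0 ^+ 2 =
    \sum_r (B^T *m y - B^T *m u) (Rank j' r) 0 ^+ 2.
  by apply: eq_bigr => r _; rewrite Mz mulmxBr.
set Y := \sum_r (B^T *m y) _ _ ^+ 2; set U := \sum_(s | (sig1 s < j)%N) _.
have uU : \sum_s u s 0 ^+ 2 = U.
  rewrite /U [RHS]big_mkcond; apply: eq_bigr => s _.
  by rewrite mxE; case: ifP; rewrite // expr0n.
have := HC' u; rewrite uU => HU.
have : \sum_(r < p j') (B^T *m u) (Rank j' r) 0 ^+ 2 <= C' * U.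
  apply: le_trans HU; rewrite -(sum_tagnat_block (fun s => (B^T *m u) s 0 ^+ 2)).
  by rewrite [leRHS](bigID (fun s => sig1 s == j'))/= lerDl sumr_ge0// => s _; exact: sqr_ge0.
set Z := \sum_(r < p j') _ => HZ.
apply: (@le_trans _ _ (2 * Y + 2 * Z)).
  rewrite !mulr_sumr -big_split; apply: ler_sum => r _ /=; rewrite [leLHS]expr2 !mxE.
  set a := \sum_i _; set b := \sum_i _.
  by have := sqr_ge0 (a + b); nra.
have Y0 : 0 <= Y by apply: sumr_ge0 => r _; exact: sqr_ge0.
have U0 : 0 <= U by apply: sumr_ge0 => r _; exact: sqr_ge0.
have := mulr_ge0 (ltW C'0) Y0; nra.
Qed.

(** Induction on the block index, using the induction hypothesis for both [y] and [A *m y]; the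
    latter raises the order of each coefficient by one. *)
Lemma observability (R : realType) n nu (beta : 'I_n -> nat) (A : 'M[R]_n) :
  (forall j, (j < nu)%N -> exists2 C, 0 < C & forall y : 'cV_n,
    \sum_(s | beta s == j.+1) y s 0 ^+ 2 <=
    C * (\sum_(s | beta s == j) (A *m y) s 0 ^+ 2 +
         \sum_(s | (beta s < j.+1)%N) y s 0 ^+ 2)) ->
  forall i, (beta i <= nu)%N -> exists2 C, 0 < C & forall y : 'cV_n,
    y i 0 ^+ 2 <=
    C * \sum_(k < (beta i).+1) \sum_(l | beta l == 0%N) (A ^+ k *m y) l 0 ^+ 2.
Proof.
move=> Hstep i; pose V k (y : 'cV[R]_n) := \sum_(l | beta l == 0%N) (A ^+ k *m y) l 0 ^+ 2.
have V0 k y : 0 <= V k y by rewrite sumr_ge0// => l _; exact: sqr_ge0.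
suff H j : (j <= nu)%N -> exists2 C, 0 < C & forall y : 'cV_n,
    \sum_(s | (beta s < j.+1)%N) y s 0 ^+ 2 <= C * \sum_(k < j.+1) V k y.
  move=> /H[C C0 HC]; exists C => // y; apply: le_trans (HC y).
  by rewrite (bigD1 i)//= lerDl sumr_ge0// => l _; exact: sqr_ge0.
elim: j => [_|j IH jnu].
  exists 1 => // y; rewrite mul1r big_ord1 /V expr0 mul1mx le_eqVlt.
  by apply/orP; left; apply/eqP/eq_bigl => s; rewrite ltnS leqn0.
have [C C0 HC] := IH (ltnW jnu); have [C' C'0 HC'] := Hstep j jnu.
(* From [Y <= C S] and [Y' <= C' (C S + Y)]. *)
exists ((1 + C') * C + C' * C) => [|y].
  by rewrite addr_gt0 ?mulr_gt0// addr_gt0.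
rewrite (bigID (fun s => (beta s < j.+1)%N))/=.
rewrite (eq_bigl (fun s => (beta s < j.+1)%N)); last first.
  by move=> s /=; case: (ltnP (beta s) j.+1); rewrite ?andbF// andbT => /ltnW.
rewrite [X in _ + X](eq_bigl (fun s => beta s == j.+1)); last first.
  by move=> s /=; rewrite -leqNgt eqn_leq ltnS.
set Y := \sum_(s | (beta s < j.+1)%N) _; set Y' := \sum_(s | _ == _) _.
set S := \sum_(k < j.+2) V k y.
have SA : \sum_(k < j.+1) V k (A *m y) <= S.
  rewrite /S [leRHS]big_ord_recl ler_wpDl// le_eqVlt; apply/orP; left; apply/eqP.
  by apply: eq_bigr => k _; rewrite lift0 /V exprSr -mulmxE -mulmxA.
have S1 : \sum_(k < j.+1) V k y <= S by rewrite /S [leRHS]big_ord_recr lerDl.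
have YS : Y <= C * S by apply: le_trans (HC y) _; rewrite ler_wpM2l ?(ltW C0).
have AS : \sum_(s | beta s == j) (A *m y) s 0 ^+ 2 <= C * S.
  apply: (@le_trans _ _ (C * \sum_(k < j.+1) V k (A *m y))).
    apply: le_trans (HC _); rewrite [leRHS](bigID (fun s => beta s == j))/=.
    rewrite [X in X + _](eq_bigl (fun s => beta s == j)).
      by rewrite lerDl sumr_ge0// => l _; exact: sqr_ge0.
    by move=> s /=; case: eqP => [->|]; rewrite ?andbF// ltnSn.
  by rewrite ler_wpM2l ?(ltW C0).
have := HC' y; rewrite -/Y -/Y' => HY'.
have := ler_wpM2l (ltW C'0) YS; have := ler_wpM2l (ltW C'0) AS; lra.
Qed.

Lemma quad_form_block_ge (R : realType) nu (p : 'I_nu.+1 -> nat)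
    (Q : 'M[R]_(\sum_i p i)) :
  sym_pd (submxblock Q ord0 ord0) ->
  (forall i j, (i, j) != (ord0, ord0) -> submxblock Q i j = 0) ->
  exists2 q, 0 < q & forall x : 'cV_(\sum_i p i),
    q * \sum_(s | sig1 s == 0%N :> nat) x s 0 ^+ 2 <= quad_form Q x.
Proof.
move=> Q00 Qother; have [q q0 Hq] := sym_pd_coercive Q00; exists q => // x.
have := Hq (submxcol x ord0); rewrite !quad_form_sum.
have -> : \sum_i submxcol x ord0 i 0 ^+ 2 = \sum_(s | sig1 s == 0%N :> nat) x s 0 ^+ 2.
  rewrite (sum_tagnat_block (fun s => x s 0 ^+ 2) ord0).
  by apply: eq_bigr => r _; rewrite mxE.
move=> /le_trans; apply; rewrite le_eqVlt; apply/orP; left; apply/eqP; symmetry.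
rewrite sum_tagnat (bigD1 ord0)//= [X in _ + X]big1 ?addr0 => [|l l0].
  apply: eq_bigr => r _; rewrite sum_tagnat (bigD1 ord0)//= [X in _ + X]big1 ?addr0 => [|l l0].
    by apply: eq_bigr => r' _; rewrite !mxE.
  apply: big1 => r' _; have /matrixP/(_ r r') : submxblock Q ord0 l = 0.
    by apply: Qother; rewrite xpair_eqE negb_and l0 orbT.
  by rewrite !mxE => ->; rewrite mulr0 mul0r.
apply: big1 => r _; rewrite sum_tagnat; apply: big1 => l' _; apply: big1 => r' _.
have /matrixP/(_ r r') : submxblock Q l l' = 0.
  by apply: Qother; rewrite xpair_eqE negb_and l0.
by rewrite !mxE => ->; rewrite mulr0 mul0r.
Qed.

(** Counting coordinates instead of blocks turns [D] into the exponent of [t] in the determinant of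
    the small-time diagonal matrix. *)
Lemma local_hom_dimE nu (p : 'I_nu.+1 -> nat) :
  local_hom_dim p = (\sum_(s < \sum_i p i) (sig1 s).*2.+1)%N.
Proof.
rewrite [RHS](@sum_tagnat nat); apply: eq_bigr => l _.
under eq_bigr do rewrite Rank1K.
by rewrite sum_nat_const card_ord mulnC.
Qed.

(** [D] is a sum of [n] odd weights, so [D <= n] forces them all to be 1. Every coordinate then lies
    in block 0, and [Q] is definite, hence of full rank. *)
Lemma ltn_local_hom_dim (R : realType) nu (p : 'I_nu.+1 -> nat)
    (Q : 'M[R]_(\sum_i p i)) (q : R) :
  0 < q -> (forall x : 'cV_(\sum_i p i),
    q * \sum_(s | sig1 s == 0%N :> nat) x s 0 ^+ 2 <= quad_form Q x) ->
  (\rank Q < \sum_i p i)%N -> (\sum_i p i < local_hom_dim p)%N.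
Proof.
move=> q0 HQ; apply: contraTT; rewrite -!leqNgt local_hom_dimE => le_D.
have beta0 (s : 'I_(\sum_i p i)) : sig1 s = 0%N :> nat.
  have DE m (f : 'I_m -> nat) : (\sum_s (f s).+1 = \sum_s f s + m)%N.
    under eq_bigr do rewrite -addn1.
    by rewrite big_split /= sum1_card card_ord.
  move: le_D; rewrite DE -[leqRHS]add0n leq_add2r leqn0 sum_nat_eq0.
  by move=> /forallP H; apply/eqP; rewrite -double_eq0; exact: H.
suff /eqP-> : row_free Q by [].
apply: inj_row_free => v vQ; have := HQ v^T.
have -> : \sum_(s | sig1 s == 0%N :> nat) v^T s 0 ^+ 2 = \sum_s v^T s 0 ^+ 2.
  by apply: eq_bigl => s; rewrite beta0.
rewrite /quad_form trmxK vQ mul0mx mxE pmulr_rle0// => le0.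
have /eqP : \sum_s v^T s 0 ^+ 2 = 0.
  by apply/eqP; rewrite eq_le le0 sumr_ge0// => s _; exact: sqr_ge0.
rewrite psumr_eq0 => [/allP v0|s _]; last exact: sqr_ge0.
apply/matrixP => i s; have := v0 s; rewrite mem_index_enum ord1 !mxE sqrf_eq0.
by move=> /(_ isT)/eqP.
Qed.

Theorem theorem1p4 (R : realType) (n nu : nat) (p : 'I_nu.+1 -> nat)
    (e : n = (\sum_i p i)%N) (Q B : 'M[R]_n)
    (hQB : standing_assumptions e Q B)
    (hrank : (\rank Q < n)%N)
    (hskew : exists S : 'M[R]_n, S^T = - S /\ similar_in unitmx B S) :
  let D := local_hom_dim p in
  let Dinf := n in
  [/\ (2 <= Dinf)%N, (Dinf < D)%N &
      exists2 gamma : R, 0 < gamma &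
        forall t : R, 0 < t -> gamma * Num.min (t ^+ D) (t ^+ Dinf) <= volume Q B t].
Proof.
move=> D Dinf; rewrite {}/D {}/Dinf.
case: hQB => n2 Qpsd _ can; subst n; rewrite !castmx_id in can.
case: can => _ _ Q00 Qother Bsub Bbelow.
have [q q0 HQ] := quad_form_block_ge Q00 Qother.
split=> //; first exact: ltn_local_hom_dim q0 HQ hrank.
have [S [Sskew [P Pu /(similarLR Pu) BS]]] := hskew.
rewrite local_hom_dimE.
(* Transposing [B = P^-1 S P] gives [(P^T)^-1 B^T = S^T (P^T)^-1], hence these choices of [W] and of
   the skew matrix. *)
apply: (@det_gramian_ge R _ nu (fun s => sig1 s) B Q (invmx P^T) S^T q) => //.
- by move=> i; rewrite -ltnS ltn_ord.
- move=> i; apply: (@observability R _ nu (fun s => sig1 s)); last by rewrite -ltnS ltn_ord.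
  move=> j jnu; have j1 : (j.+1 < nu.+1)%N by rewrite ltnS.
  have j2 : (j < nu.+1)%N by rewrite ltnW.
  apply: (@block_step R _ p B (Ordinal j1) (Ordinal j2)) => //.
  + exact: Bsub.
  + by move=> l jl; exact: Bbelow.
- by rewrite unitmx_inv unitmx_tr.
- by rewrite trmxK Sskew opprK.
rewrite BS conjVmx// !trmx_mul mulKmx ?unitmx_tr// -trmx_inv.
by [].
Qed.
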